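(* Let $M$ be an object of an abelian category $\mathcal{A}$. Then: (1) $M$ is strongly self-CS-Rickart if and only if $M$ is self-CS-Rickart and the ring ${\rm End}_{\mathcal{A}}(M)$ is abelian. (2) $M$ is dual strongly self-CS-Rickart if and only if $M$ is dual self-CS-Rickart and the ring ${\rm End}_{\mathcal{A}}(M)$ is abelian.
   Context: A ring is called abelian if every idempotent element of it is central. Let $\mathcal{A}$ be an abelian category. A monomorphism $f:K\to M$ is essential if, for every morphism $h:M\to P$, $hf$ monomorphism implies $h$ monomorphism; it is fully invariant if for every $h:M\to M$ there is $\alpha:K\to K$ with $hf=f\alpha$. An epimorphism $g:M\to N$ is superfluous if, for every morphism $h:Q\to M$, $gh$ epimorphism implies $h$ epimorphism; it is fully coinvariant if for every $h:M\to M$ there is $\beta:N\to N$ with $gh=\beta g$. A section is a morphism with a left inverse; a retraction is a morphism with a right inverse. For objects $M,N$ of $\mathcal{A}$: $N$ is $M$-CS-Rickart (resp. strongly $M$-CS-Rickart) if for every $f:M\to N$ there are an essential monomorphism $e:{\rm Ker}(f)\to L$ and a section (resp. fully invariant section) $s:L\to M$ with ${\rm ker}(f)=se$. $N$ is dual $M$-CS-Rickart (resp. dual strongly $M$-CS-Rickart) if for every $f:M\to N$ there are a retraction (resp. fully coinvariant retraction) $r:N\to P$ and a superfluous epimorphism $t:P\to{\rm Coker}(f)$ with ${\rm coker}(f)=tr$. An object $N$ is (dual) (strongly) self-CS-Rickart if it is (dual) (strongly) $N$-CS-Rickart. *)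

(* Defs.v *)
From HB Require Import structures.
From mathcomp Require Import all_boot all_algebra.
From mathcomp Require Import boolp.

Set Implicit Arguments.
Unset Strict Implicit.
Unset Printing Implicit Defensive.

Import GRing.Theory.
Local Open Scope ring_scope.

(** Composition is written in the usual order: [compose g f] is [g] after [f]. *)
Record preadditive_category := PreadditiveCategory {
  obj :> Type;
  Mor : obj -> obj -> zmodType;
  idm : forall A, Mor A A;
  compose : forall A B C, Mor B C -> Mor A B -> Mor A C;
  composeA : forall A B C D (h : Mor C D) (g : Mor B C) (f : Mor A B),
    compose h (compose g f) = compose (compose h g) f;
  compose1m : forall A B (f : Mor A B), compose (idm B) f = f;
  composem1 : forall A B (f : Mor A B), compose f (idm A) = f;
  composeDl : forall A B C (g g' : Mor B C) (f : Mor A B),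
    compose (g + g') f = compose g f + compose g' f;
  composeDr : forall A B C (g : Mor B C) (f f' : Mor A B),
    compose g (f + f') = compose g f + compose g f'
}.

Arguments idm {p} A.
Arguments compose {p A B C} g f.
Declare Scope cat_scope.
Delimit Scope cat_scope with cat.
Notation "g ∘ f" := (compose g f) (at level 40, left associativity) : cat_scope.
Local Open Scope cat_scope.

(** The zero ring is allowed, since the endomorphism ring of a zero object
    is zero: hence [pzRingType] and not [nzRingType]. *)
Definition abelian_ring (R : pzRingType) : Prop :=
  forall e : R, e * e = e -> forall x : R, GRing.comm e x.

Section Preadditive.
Variable C : preadditive_category.
Implicit Types A B K L M N P Q Z : C.

Definition End M : Type := Mor M M.

HB.instance Definition _ M := GRing.Zmodule.on (End M).
HB.instance Definition _ M := GRing.Zmodule_isPzRing.Build (End M)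
  (fun f g h : Mor M M => composeA f g h)
  (fun f : Mor M M => compose1m f) (fun f : Mor M M => composem1 f)
  (fun f g h : Mor M M => composeDl f g h)
  (fun f g h : Mor M M => composeDr f g h).

Definition mono A B (f : Mor A B) : Prop :=
  forall Q (u v : Mor Q A), f ∘ u = f ∘ v -> u = v.

Definition epi A B (f : Mor A B) : Prop :=
  forall Q (u v : Mor B Q), u ∘ f = v ∘ f -> u = v.

Definition is_section A B (f : Mor A B) : Prop :=
  exists r : Mor B A, r ∘ f = idm A.

Definition is_retraction A B (f : Mor A B) : Prop :=
  exists s : Mor B A, f ∘ s = idm B.

Definition is_zero_object Z : Prop :=
  forall A, (exists! f : Mor A Z, True) /\ (exists! f : Mor Z A, True).

Definition is_biproduct A B P (i1 : Mor A P) (i2 : Mor B P)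
    (p1 : Mor P A) (p2 : Mor P B) : Prop :=
  [/\ p1 ∘ i1 = idm A, p2 ∘ i2 = idm B, p1 ∘ i2 = 0, p2 ∘ i1 = 0
    & i1 ∘ p1 + i2 ∘ p2 = idm P].

Definition is_kernel A B (f : Mor A B) K (k : Mor K A) : Prop :=
  f ∘ k = 0 /\
  forall Q (u : Mor Q A), f ∘ u = 0 -> exists! v : Mor Q K, k ∘ v = u.

Definition is_cokernel A B (f : Mor A B) P (c : Mor B P) : Prop :=
  c ∘ f = 0 /\
  forall Q (u : Mor B Q), u ∘ f = 0 -> exists! v : Mor P Q, v ∘ c = u.

Record is_abelian : Prop := IsAbelian {
  has_zero_object : exists Z, is_zero_object Z;
  has_biproducts : forall A B, exists P (i1 : Mor A P) (i2 : Mor B P)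
    (p1 : Mor P A) (p2 : Mor P B), is_biproduct i1 i2 p1 p2;
  has_kernels : forall A B (f : Mor A B),
    exists K (k : Mor K A), is_kernel f k;
  has_cokernels : forall A B (f : Mor A B),
    exists P (c : Mor B P), is_cokernel f c;
  mono_is_kernel : forall A B (f : Mor A B), mono f ->
    exists P (g : Mor B P), is_kernel g f;
  epi_is_cokernel : forall A B (f : Mor A B), epi f ->
    exists K (g : Mor K A), is_cokernel g f
}.

Definition essential_mono K M (f : Mor K M) : Prop :=
  mono f /\ forall P (h : Mor M P), mono (h ∘ f) -> mono h.

Definition fully_invariant_mono K M (f : Mor K M) : Prop :=
  mono f /\ forall h : Mor M M, exists a : Mor K K, h ∘ f = f ∘ a.

Definition superfluous_epi M N (g : Mor M N) : Prop :=
  epi g /\ forall Q (h : Mor Q M), epi (g ∘ h) -> epi h.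

Definition fully_coinvariant_epi M N (g : Mor M N) : Prop :=
  epi g /\ forall h : Mor M M, exists b : Mor N N, g ∘ h = b ∘ g.

End Preadditive.

Record abelian_category := AbelianCategory {
  abelian_base :> preadditive_category;
  abelianP : is_abelian abelian_base
}.

Section Abelian.
Variable C : abelian_category.
Implicit Types L M N P : C.

Definition Ker M N (f : Mor M N) : C :=
  projT1 (cid (has_kernels (abelianP C) f)).
Definition ker M N (f : Mor M N) : Mor (Ker f) M :=
  projT1 (cid (projT2 (cid (has_kernels (abelianP C) f)))).

Definition Coker M N (f : Mor M N) : C :=
  projT1 (cid (has_cokernels (abelianP C) f)).
Definition coker M N (f : Mor M N) : Mor N (Coker f) :=
  projT1 (cid (projT2 (cid (has_cokernels (abelianP C) f)))).

Lemma kerP M N (f : Mor M N) : is_kernel f (ker f).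
Proof. exact: projT2 (cid (projT2 (cid (has_kernels (abelianP C) f)))). Qed.

Lemma cokerP M N (f : Mor M N) : is_cokernel f (coker f).
Proof. exact: projT2 (cid (projT2 (cid (has_cokernels (abelianP C) f)))). Qed.

(** [CS_Rickart M N] reads "[N] is [M]-CS-Rickart"; the same argument order
    is used for the three variants below. *)
Definition CS_Rickart M N : Prop :=
  forall f : Mor M N, exists L (e : Mor (Ker f) L) (s : Mor L M),
    [/\ essential_mono e, is_section s & ker f = s ∘ e].

Definition strongly_CS_Rickart M N : Prop :=
  forall f : Mor M N, exists L (e : Mor (Ker f) L) (s : Mor L M),
    [/\ essential_mono e, is_section s, fully_invariant_mono s
      & ker f = s ∘ e].

Definition dual_CS_Rickart M N : Prop :=
  forall f : Mor M N, exists P (r : Mor N P) (t : Mor P (Coker f)),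
    [/\ is_retraction r, superfluous_epi t & coker f = t ∘ r].

Definition dual_strongly_CS_Rickart M N : Prop :=
  forall f : Mor M N, exists P (r : Mor N P) (t : Mor P (Coker f)),
    [/\ is_retraction r, fully_coinvariant_epi r, superfluous_epi t
      & coker f = t ∘ r].

Definition self_CS_Rickart N : Prop := CS_Rickart N N.
Definition strongly_self_CS_Rickart N : Prop := strongly_CS_Rickart N N.
Definition dual_self_CS_Rickart N : Prop := dual_CS_Rickart N N.
Definition dual_strongly_self_CS_Rickart N : Prop :=
  dual_strongly_CS_Rickart N N.

End Abelian.

(* Main.v *)
Require Import Defs.
From mathcomp Require Import all_boot all_algebra.

(** An idempotent [e] is central as soon as [(1 - e) x e = 0] and
    [e x (1 - e) = 0] for every [x], that is, as soon as the kernels of [1 - e]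
    and of [e] are fully invariant.  These kernels are sections, so an essential
    monomorphism through which one of them factors is an isomorphism, and full
    invariance passes from the direct summand to the kernel.  Conversely a
    section [s] with left inverse [r] is fully invariant when the idempotent
    [s r] is central.  Part (2) is part (1) in the opposite category. *)

Set Implicit Arguments.
Unset Strict Implicit.
Unset Printing Implicit Defensive.

Import GRing.Theory.
Local Open Scope ring_scope.
Local Open Scope cat_scope.

Lemma stable_idempotents_abelian (R : pzRingType) :
  (forall e x : R, e * e = e -> x * e = e * (x * e)) -> abelian_ring R.
Proof.
move=> stable e ee x; rewrite /GRing.comm (stable e x ee).
have ff : (1 - e) * (1 - e) = 1 - e.
  by rewrite mulrBr mulr1 mulrBl mul1r ee subrr subr0.
have : e * (x * (1 - e)) = 0.
  by rewrite (stable _ x ff) mulrA [e * (1 - e)]mulrBr mulr1 ee subrr mul0r.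
by rewrite mulrBr mulr1 mulrBr => /eqP; rewrite subr_eq0 => /eqP.
Qed.

Section PreadditiveLemmas.
Variable C : preadditive_category.
Implicit Types K L M : C.

Lemma section_mono L M (s : Mor L M) : is_section s -> mono s.
Proof.
move=> [r rs] Q u v suv.
by rewrite -[u]compose1m -[v]compose1m -rs -!composeA suv.
Qed.

(** Essentiality makes [r] a monomorphism because [r ∘ e] is one, and [r] then cancels from r e r =
    r. *)
Lemma essential_section_iso K L (e : Mor K L) (r : Mor L K) :
  essential_mono e -> r ∘ e = idm K -> e ∘ r = idm L.
Proof.
move=> [_ ess_e] re.
have r_mono : mono r.
  by apply: ess_e; rewrite re => Q u v; rewrite !compose1m.
by apply: r_mono; rewrite composeA re compose1m composem1.
Qed.

(** The kernel of [1 - e] is the image of [e]: one has [e = k ∘ p] with [p ∘ k] the identity. Hence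
    [i] is invertible, [e ∘ s = s], and x e = x s i p = s a i p for some [a], which [e] fixes
    too. *)
Lemma idempotent_stable M (e x : End M) K (k : Mor K M) L (i : Mor K L)
    (s : Mor L M) :
  e * e = e -> is_kernel (1 - e : End M) k ->
  essential_mono i -> is_section s -> fully_invariant_mono s -> k = s ∘ i ->
  x * e = e * (x * e).
Proof.
move=> ee [k0 k_univ] ess_i [r rs] [_ s_inv] kE.
have [p [kp _]] : exists! p : Mor M K, k ∘ p = e.
  by apply: k_univ; change ((1 - e) * e = 0); rewrite mulrBl mul1r ee subrr.
have k_mono : mono k.
  by rewrite kE => Q u v; rewrite -!composeA =>
    /(section_mono (ex_intro _ r rs)) /ess_i.1.
have pk : p ∘ k = idm K.
  apply: k_mono; rewrite composeA kp composem1.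
  have := k0; rewrite composeDl => /eqP.
  have -> : (- e : Mor M M) ∘ k = - (e ∘ k).
    apply/eqP; rewrite -addr_eq0 -composeDl addNr.
    by rewrite -(addrK (0 ∘ k) (0 ∘ k)) -composeDl addr0 subrr.
  by rewrite compose1m subr_eq0 => /eqP.
have ir : i ∘ (p ∘ s) = idm L.
  by apply: essential_section_iso ess_i _; rewrite -composeA -kE.
have [a xs] := s_inv x.
have sE : s = e ∘ s.
  by rewrite -kp kE -!composeA ir composem1.
change (x ∘ e = e ∘ (x ∘ e)).
by rewrite -{1 3}kp kE !composeA -(composeA e x s) xs composeA -sE.
Qed.

Lemma central_section_fully_invariant L M (s : Mor L M) :
  abelian_ring (End M) -> is_section s -> fully_invariant_mono s.
Proof.
move=> abM sec_s; split; first exact: section_mono.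
(* The witness comes from h s = h (s r) s = (s r) h s. *)
have [r rs] := sec_s => h; exists (r ∘ h ∘ s).
have sr_idem : (s ∘ r : End M) * (s ∘ r) = s ∘ r.
  by change (s ∘ r ∘ (s ∘ r) = s ∘ r); rewrite composeA -(composeA s) rs composem1.
have /= comm : s ∘ r ∘ h = h ∘ (s ∘ r) := abM _ sr_idem h.
by rewrite !composeA comm -!composeA rs composem1.
Qed.

(* The kernels are an arbitrary choice [k], so that the result also applies to
   chosen cokernels, which are kernels in the opposite category. *)
Lemma strongly_CS_iff_abelian M (K : Mor M M -> C)
    (k : forall f : Mor M M, Mor (K f) M) :
  (forall f, is_kernel f (k f)) ->
  (forall f, exists L (e : Mor (K f) L) (s : Mor L M),
     [/\ essential_mono e, is_section s, fully_invariant_mono s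
       & k f = s ∘ e]) <->
  (forall f, exists L (e : Mor (K f) L) (s : Mor L M),
     [/\ essential_mono e, is_section s & k f = s ∘ e]) /\
  abelian_ring (End M).
Proof.
move=> kP; split=> [strong | [cs abM] f]; last first.
  have [L [e [s [ess_e sec_s kE]]]] := cs f.
  by exists L, e, s; split=> //; exact: central_section_fully_invariant.
split=> [f | ].
  by have [L [e [s [? ? _ ?]]]] := strong f; exists L, e, s.
apply: stable_idempotents_abelian => e x ee.
have [L [i [s [ess_i sec_s inv_s kE]]]] := strong (1 - e : End M).
exact: idempotent_stable ee (kP _) ess_i sec_s inv_s kE.
Qed.

(** The equivalence above takes its kernels as given, so only the preadditive structure is
    dualised. *)
Definition opposite : preadditive_category :=
  {| obj := C;
     Mor A B := Mor B A;
     idm A := idm A;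
     compose _ _ _ g f := f ∘ g;
     composeA _ _ _ _ h g f := esym (composeA f g h);
     compose1m _ _ f := composem1 f;
     composem1 _ _ f := compose1m f;
     composeDl _ _ _ g g' f := composeDr f g g';
     composeDr _ _ _ g f f' := composeDl f f' g |}.

Lemma abelian_End_opposite M :
  abelian_ring (End (M : opposite)) <-> abelian_ring (End M).
Proof. by split=> abM e ee x; exact: esym (abM e ee x). Qed.

End PreadditiveLemmas.

Theorem proposition2p8 (A : abelian_category) (M : A) :
  (strongly_self_CS_Rickart M <->
     self_CS_Rickart M /\ abelian_ring (End M)) /\
  (dual_strongly_self_CS_Rickart M <->
     dual_self_CS_Rickart M /\ abelian_ring (End M)).
Proof.
split; first exact: (strongly_CS_iff_abelian (@kerP A M M)).
have [to_ab of_ab] :=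
  @strongly_CS_iff_abelian (opposite A) M _ _ (@cokerP A M M).
split=> [strong | [cs abM]].
  have [|cs /abelian_End_opposite abM] := to_ab.
    by move=> f; have [P [r [t [? ? ? ?]]]] := strong f; exists P, t, r.
  by split=> // f; have [P [t [r [? ? ?]]]] := cs f; exists P, r, t.
move=> f; have [|P [t [r [? ? ? ?]]]] := of_ab _ f; last by exists P, r, t.
split; last exact/abelian_End_opposite.
by move=> g; have [P [r [t [? ? ?]]]] := cs g; exists P, t, r.
Qed.
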